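(* Let $\{K_j\}_{j=1}^m$ be a clique cover of a finite graph on the node set $[n]$, let $\mathbf{c}\in\mathbb{R}^{n+m}$ be a cost vector with $c_{n+j}=0$ for $j\in[m]$, let $T>0$, and let $\boldsymbol\lambda\in\mathbb{R}^m$ be arbitrary. Run the naive Bregman method (see context) with input $(\boldsymbol\lambda,T)$ for infinitely many iterations. Then its iterates $\mathbf{x}$ converge to the solution of the smoothed clique cover relaxation $$\max_{\mathbf{x}\in[0,1]^{n+m}}\ \langle\mathbf{c},\mathbf{x}\rangle+T\,\mathcal{H}(\mathbf{x})\qquad\text{s.t.}\qquad \sum_{i\in\bar K_j}x_i=1,\ j\in[m].$$
   Context: Notation: $[k]=\{1,\dots,k\}$. Let $\mathcal{G}=(\mathcal{V},\mathcal{E})$ be a finite undirected graph with $\mathcal{V}=[n]$. A clique cover is a family of subsets $K_j\subseteq\mathcal{V}$, $j\in[m]$, each inducing a complete subgraph of $\mathcal{G}$, that covers all edges and nodes: $\mathcal{E}=\bigcup_{j}\{\{i,i'\}\mid i,i'\in K_j,\ i\neq i'\}$ and $\mathcal{V}=\bigcup_j K_j$. For each clique introduce a slack index $n+j$ with cost $c_{n+j}=0$ and put $\bar K_j=K_j\cup\{n+j\}$. For $i\in[n+m]$ let $J_i=\{j\in[m]\mid i\in\bar K_j\}$. For $\boldsymbol\lambda\in\mathbb{R}^m$ the reduced costs are $c^{\boldsymbol\lambda}_i=c_i-\sum_{j\in J_i}\lambda_j$, $i\in[n+m]$. The (shifted) entropy is $\mathcal{H}(\mathbf{x})=-\sum_{i=1}^{n+m}(x_i\log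 x_i-x_i)$ with $0\log0=0$. Naive Bregman method. Input: $\boldsymbol\lambda\in\mathbb{R}^m$, $T>0$. Initialize $x_i=\exp(c^{\boldsymbol\lambda}_i/T)$ for all $i\in[n+m]$. Repeat outer iterations; each outer iteration loops over the cliques $j=1,\dots,m$ and for each $j$ computes $s:=\sum_{i\in\bar K_j}x_i$ and then updates $x_i:=x_i/s$ for all $i\in\bar K_j$ (other coordinates unchanged). *)

(* Defs.v *)
From HB Require Import structures.
From mathcomp Require Import all_boot all_order all_algebra.
From mathcomp Require Import all_classical all_reals all_analysis.

Set Implicit Arguments.
Unset Strict Implicit.
Unset Printing Implicit Defensive.

Import Order.TTheory GRing.Theory Num.Theory.
Import numFieldNormedType.Exports.

Local Open Scope ring_scope.

(* A graph on the node set 'I_n is given by its set of edges, each edge being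
   an unordered pair of distinct nodes. *)
Definition is_edge_set (n : nat) (E : {set {set 'I_n}}) : Prop :=
  forall A : {set 'I_n}, A \in E -> #|A| = 2%N.

Definition is_clique (n : nat) (E : {set {set 'I_n}}) (A : {set 'I_n}) : Prop :=
  forall i i' : 'I_n, i \in A -> i' \in A -> i != i' -> [set i; i']%SET \in E.

Definition is_clique_cover (n m : nat) (E : {set {set 'I_n}})
    (K : 'I_m -> {set 'I_n}) : Prop :=
  [/\ forall j : 'I_m, is_clique E (K j),
      E = (\bigcup_(j < m)
             [set [set i; i'] | i in K j, i' in K j & i != i'])%SET
    & [set: 'I_n]%SET = (\bigcup_(j < m) K j)%SET].

(* In 'I_(n + m), node i is [lshift m i] and the slack index of the j-th
   clique is [rshift n j]. *)
Definition ext_clique (n m : nat) (K : 'I_m -> {set 'I_n}) (j : 'I_m) :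
    {set 'I_(n + m)} :=
  (rshift n j |: [set lshift m i | i in K j])%SET.

Definition cliques_of (n m : nat) (K : 'I_m -> {set 'I_n}) (i : 'I_(n + m)) :
    {set 'I_m} :=
  [set j | i \in ext_clique K j]%SET.

Section Relaxation.
Variables (R : realType) (n m : nat) (K : 'I_m -> {set 'I_n}).
Implicit Types (c x : 'rV[R]_(n + m)) (T : R) (lambda : 'rV[R]_m).

Definition reduced_cost c lambda (i : 'I_(n + m)) : R :=
  c 0 i - \sum_(j in cliques_of K i) lambda 0 j.

(* [ln 0 = 0] in the library, so the convention 0 log 0 = 0 holds. *)
Definition entropy x : R :=
  - \sum_(i < n + m) (x 0 i * ln (x 0 i) - x 0 i).

Definition smoothed_objective c T x : R :=
  \sum_(i < n + m) c 0 i * x 0 i + T * entropy x.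

Definition feasible x : Prop :=
  (forall i : 'I_(n + m), 0 <= x 0 i <= 1) /\
  (forall j : 'I_m, \sum_(i in ext_clique K j) x 0 i = 1).

Definition is_solution c T x : Prop :=
  feasible x /\
  (forall y, feasible y -> smoothed_objective c T y <= smoothed_objective c T x).

Definition bregman_init c lambda T : 'rV[R]_(n + m) :=
  \row_i expR (reduced_cost c lambda i / T).

Definition bregman_step x (j : 'I_m) : 'rV[R]_(n + m) :=
  let s := \sum_(i in ext_clique K j) x 0 i in
  \row_i (if i \in ext_clique K j then x 0 i / s else x 0 i).

Definition bregman_outer x : 'rV[R]_(n + m) :=
  foldl bregman_step x (enum 'I_m).

(* The vector after [t] clique updates in total, that is [t %/ m] complete
   outer iterations followed by the first [t %% m] updates of the next one
   (for m = 0 there are no updates and the sequence is constant). *)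
Definition bregman_iterate c lambda T (t : nat) : 'rV[R]_(n + m) :=
  foldl bregman_step (iter (t %/ m)%N bregman_outer (bregman_init c lambda T))
    (take (t %% m)%N (enum 'I_m)).

End Relaxation.

(* Main.v *)
(* On the constraint set the smoothed objective at y equals a constant minus
   T * kl y x0, where kl is the generalized Kullback-Leibler divergence and x0
   the initial point, so the problem is to project x0 onto that set. Rescaling
   a block of mass s lowers kl y x by s - 1 - ln s >= 0 for every y meeting the
   constraints. These losses are summable, which forces the masses to 1; they
   do not depend on y, so kl y x - kl z x is preserved for all y and z meeting
   the constraints. Sublevel sets of kl y are compact for y > 0, so the iterates
   have a cluster point xs > 0, which meets the constraints. As kl xs decreases
   along the iterates and vanishes at xs, it tends to 0 and the iterates
   converge to xs. In the limit the preserved differences give the Pythagorean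
   identity kl y x0 = kl y xs + kl xs x0, whence xs is the only maximizer. *)
Require Import Defs.
From mathcomp Require Import all_boot all_order all_algebra.
From mathcomp Require Import all_classical all_reals all_analysis.
From mathcomp Require Import ring lra.

Set Implicit Arguments.
Unset Strict Implicit.
Unset Printing Implicit Defensive.

Import Order.TTheory GRing.Theory Num.Theory.
Import numFieldNormedType.Exports.

Local Open Scope classical_set_scope.
Local Open Scope ring_scope.

Lemma exists_addn_modn (m t : nat) (j : 'I_m) :
  exists2 k, (k <= m)%N & ((t + k) %% m)%N = j.
Proof.
have m_gt0 : (0 < m)%N by exact: leq_ltn_trans (ltn_ord j).
exists ((m - t %% m + j) %% m)%N; first by rewrite ltnW ?ltn_pmod.
rewrite modnDmr addnA -modnDml -(modnDml t) subnKC 1?ltnW ?ltn_pmod //.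
by rewrite modnn add0n modn_small.
Qed.

Lemma cluster_continuous_cvg (T U : topologicalType) (F : set_system T)
    {FF : Filter F} (g : T -> U) (p : T) (l : U) : hausdorff_space U ->
  {for p, continuous g} -> cluster F p -> g @ F --> l -> g p = l.
Proof.
move=> U_hausdorff g_cont; rewrite cluster_cvgE => -[G PG [Gp FG]] gl.
apply: (cvg_unique U_hausdorff (F := g @ G)); first exact: cvg_comp Gp g_cont.
exact: cvg_trans (cvg_app g FG) gl.
Qed.

Lemma cvg_mx (R : numFieldType) (V : pseudoMetricType R) (m n : nat) (T : Type)
    (F : set_system T) {FF : Filter F} (u : T -> 'M[V]_(m, n))
    (x : 'M[V]_(m, n)) :
  (forall i j, u t i j @[t --> F] --> x i j) -> u @ F --> x.
Proof.
move=> ux; apply/cvg_ballP => e e_gt0.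
have : \forall t \near F, forall i j, ball (x i j) e (u t i j).
  by do 2 (apply: filter_forall => ?); apply: (cvg_ball (ux _ _)).
by apply: filterS => t uxt; split.
Qed.

Lemma cvg_sum (V : TopologicalNmodule.type) (I T : Type) (F : set_system T)
    {FF : Filter F} (r : seq I) (P : pred I) (f : I -> T -> V) (l : I -> V) :
  (forall i, P i -> f i t @[t --> F] --> l i) ->
  (\sum_(i <- r | P i) f i t) @[t --> F] --> \sum_(i <- r | P i) l i.
Proof. by move=> fl; apply: cvg_big => //; exact: add_continuous. Qed.

Lemma norm_squeeze_cvg0 (R : realFieldType) (V : pseudoMetricNormedZmodType R)
    (T : Type) (F : set_system T) {FF : Filter F} (u : T -> V) (v : T -> R) :
  (forall t, `|u t| <= v t) -> v @ F --> 0 -> u @ F --> 0.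
Proof.
move=> uv v0; apply: norm_cvg0.
apply: (@squeeze_cvgr _ _ _ _ (cst 0) v) v0; last exact: cvg_cst.
by apply: nearW => t; rewrite normr_ge0 uv.
Qed.

Lemma cvg_recurrent_value (R : numFieldType) (V : normedModType R)
    (u : nat -> V) (l : V) (p : nat) :
  (u t.+1 - u t) @[t --> \oo] --> 0 ->
  (forall t, exists2 k, (k <= p)%N & u (t + k)%N = l) -> u @ \oo --> l.
Proof.
move=> du0 ul; apply/cvgrPdist_le => e e_gt0.
have ep_gt0 : 0 < e / p.+1%:R by rewrite divr_gt0 ?ltr0n.
move/cvgrPdist_le: du0 => /(_ _ ep_gt0)[M _ du_le].
exists M => // t /= Mt; have [k kp <-] := ul t.
have {kp} : k%:R * (e / p.+1%:R) <= e.
  by rewrite mulrCA ger_pMr // ler_pdivrMr ?ltr0n // mul1r ler_nat leqW.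
apply: le_trans; elim: k => [|k IHk]; first by rewrite addn0 subrr normr0 mul0r.
have := du_le (t + k)%N (leq_trans Mt (leq_addr _ _)).
rewrite sub0r normrN -addnS => du_le_tk.
rewrite -(subrKA (u (t + k)%N)) -natr1 mulrDl mul1r [leRHS]addrC.
by apply: le_trans (ler_normD _ _) _; exact: lerD.
Qed.

Section ScalarDivergence.
Variable R : realType.
Implicit Types x y C : R.

Definition kl_term y x : R := y * (ln y - ln x) - y + x.

Lemma kl_termxx x : kl_term x x = 0.
Proof. by rewrite /kl_term subrr mulr0 sub0r addNr. Qed.

Lemma sqr_sqrtB_le_kl_term y x : 0 <= y -> 0 < x ->
  (Num.sqrt x - Num.sqrt y) ^+ 2 <= kl_term y x.
Proof.
rewrite le_eqVlt /kl_term => /predU1P[<-|y_gt0] x_gt0.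
  by rewrite sqrtr0 mul0r !subr0 add0r sqr_sqrtr // ltW.
have [a_gt0 b_gt0] : 0 < Num.sqrt y /\ 0 < Num.sqrt x by rewrite !sqrtr_gt0.
have := sqr_sqrtr (ltW y_gt0); have := sqr_sqrtr (ltW x_gt0).
set a := Num.sqrt y in a_gt0 *; set b := Num.sqrt x in b_gt0 * => <- <-.
have ba_gt0 : 0 < b / a by rewrite divr_gt0.
have : ln (1 + (b / a - 1)) <= b / a - 1 by apply: le_ln1Dx; lra.
rewrite subrKC ln_div // -(ler_pM2l (exprn_gt0 2 a_gt0)).
have -> : a ^+ 2 * (b / a - 1) = a * b - a ^+ 2 by field; rewrite gt_eqF.
by rewrite !lnXn // !mulr2n; lra.
Qed.

Lemma kl_term_ge0 y x : 0 <= y -> 0 < x -> 0 <= kl_term y x.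
Proof.
move=> y_ge0 x_gt0.
exact: le_trans (sqr_ge0 _) (sqr_sqrtB_le_kl_term y_ge0 x_gt0).
Qed.

Lemma kl_term_eq0 y x : 0 <= y -> 0 < x -> (kl_term y x == 0) = (y == x).
Proof.
move=> y_ge0 x_gt0; apply/eqP/eqP => [kl0|->]; last exact: kl_termxx.
apply/eqP; rewrite eq_sym -(eqr_sqrt (ltW x_gt0) y_ge0) -subr_eq0 -sqrf_eq0.
rewrite eq_le sqr_ge0 andbT.
by rewrite -kl0 sqr_sqrtB_le_kl_term.
Qed.

Lemma kl_term_le_lbound y x C : 0 < y -> 0 < x -> kl_term y x <= C ->
  expR (ln y - 1 - C / y) <= x.
Proof.
move=> y_gt0 x_gt0; rewrite /kl_term => xC.
rewrite -[leRHS]lnK ?posrE // ler_expR -(ler_pM2l y_gt0).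
have -> : y * (ln y - 1 - C / y) = y * ln y - y - C by field; rewrite gt_eqF.
lra.
Qed.

Lemma kl_term_le_ubound y x C : 0 <= y -> 0 < x -> kl_term y x <= C ->
  x <= 2 * (C + y).
Proof.
move=> y_ge0 x_gt0 /(le_trans (sqr_sqrtB_le_kl_term y_ge0 x_gt0)).
have := sqr_ge0 (Num.sqrt x - 2 * Num.sqrt y).
have := sqr_sqrtr y_ge0; have := sqr_sqrtr (ltW x_gt0); lra.
Qed.

Lemma cvg_kl_term0 (T : Type) (F : set_system T) {FF : Filter F}
    (u : T -> R) y :
  0 <= y -> (forall t, 0 < u t) -> kl_term y (u t) @[t --> F] --> 0 ->
  u @ F --> y.
Proof.
move=> y_ge0 u_gt0 kl0.
have sqrt_cvg : Num.sqrt (u t) @[t --> F] --> Num.sqrt y.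
  apply/subr_cvg0.
  apply: (@norm_squeeze_cvg0 _ _ _ _ _ _ (fun t => Num.sqrt (kl_term y (u t)))).
    by move=> t; rewrite -sqrtr_sqr ler_wsqrtr // sqr_sqrtB_le_kl_term.
  by rewrite -(@sqrtr0 R); apply: continuous_cvg kl0; exact: sqrt_continuous.
rewrite (_ : u = fun t => Num.sqrt (u t) ^+ 2); last first.
  by apply/funext => t; rewrite sqr_sqrtr // ltW.
by rewrite -(sqr_sqrtr y_ge0); under eq_fun do rewrite expr2; exact: cvgM.
Qed.

Lemma continuous_kl_term y x : 0 < x -> {for x, continuous (kl_term y)}.
Proof.
move=> x_gt0; apply: continuousD; last exact: cvg_id.
apply: cvgB; last exact: cvg_cst.
apply: cvgM; first exact: cvg_cst.
by apply: cvgB; [exact: cvg_cst|exact: continuous_ln].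
Qed.

End ScalarDivergence.

Section RowDivergence.
Variables (R : realType) (N : nat).
Implicit Types x y : 'rV[R]_N.

Definition pos_rV x := forall i, 0 < x 0 i.

Definition nneg_rV x := forall i, 0 <= x 0 i.

Lemma pos_rVW x : pos_rV x -> nneg_rV x.
Proof. by move=> x_gt0 i; exact: ltW. Qed.

Definition kl y x : R := \sum_i kl_term (y 0 i) (x 0 i).

Lemma klxx x : kl x x = 0.
Proof. by rewrite /kl big1 // => i _; exact: kl_termxx. Qed.

Lemma kl_ge0 y x : nneg_rV y -> pos_rV x -> 0 <= kl y x.
Proof. by move=> y_ge0 x_gt0; apply: sumr_ge0 => i _; exact: kl_term_ge0. Qed.

Lemma kl_term_le_kl y x i : nneg_rV y -> pos_rV x ->
  kl_term (y 0 i) (x 0 i) <= kl y x.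
Proof.
move=> y_ge0 x_gt0; rewrite /kl (bigD1 i) //= lerDl.
by apply: sumr_ge0 => k _; exact: kl_term_ge0.
Qed.

Lemma kl_eq0 y x : nneg_rV y -> pos_rV x -> (kl y x == 0) = (y == x).
Proof.
move=> y_ge0 x_gt0; apply/idP/eqP => [|->]; last by rewrite klxx.
rewrite psumr_eq0 => [/allP kl0|i _]; last exact: kl_term_ge0.
apply/rowP => i; apply/eqP; rewrite -kl_term_eq0 //.
exact: kl0 (mem_index_enum i).
Qed.

Lemma continuous_kl y x : pos_rV x -> {for x, continuous (kl y)}.
Proof.
move=> x_gt0; apply: (cvg_sum (F := nbhs x)) => i _.
by apply: continuous_cvg; [exact: continuous_kl_term|exact: coord_continuous].
Qed.

Lemma cvg_kl0 (T : Type) (F : set_system T) {FF : Filter F}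
    (u : T -> 'rV[R]_N) y :
  nneg_rV y -> (forall t, pos_rV (u t)) -> kl y (u t) @[t --> F] --> 0 ->
  u @ F --> y.
Proof.
move=> y_ge0 u_gt0 kl0; apply: cvg_mx => i j; rewrite ord1.
apply: (cvg_kl_term0 (u := fun t => u t 0 j)) => // [t|]; first exact: u_gt0.
apply: norm_squeeze_cvg0 kl0 => t; rewrite ger0_norm ?kl_term_ge0 //.
  exact: kl_term_le_kl.
exact: u_gt0.
Qed.

Lemma compact_kl_sublevel y C : pos_rV y ->
  compact [set x | pos_rV x /\ kl y x <= C].
Proof.
move=> y_gt0 F FF F_sublevel; have y_ge0 := pos_rVW y_gt0.
pose box i := `[expR (ln (y 0 i) - 1 - C / y 0 i), 2 * (C + y 0 i)]%classic.
have [||p [p_box p_cluster]] := rV_compact (A := box) _ FF.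
- by move=> i; exact: segment_compact.
- apply: filterS F_sublevel => x [x_gt0 xC] i; rewrite /box /= in_itv /=.
  have xiC := le_trans (kl_term_le_kl i y_ge0 x_gt0) xC.
  by rewrite kl_term_le_lbound ?kl_term_le_ubound.
have p_gt0 : pos_rV p.
  move=> i; have := p_box i; rewrite /box /= in_itv /= => /andP[p_lb _].
  exact: lt_le_trans (expR_gt0 _) p_lb.
exists p; split=> //; split=> //; rewrite leNgt; apply/negP => pC.
have near_p : nbhs p [set x | C < kl y x] := continuous_kl p_gt0 (lt_nbhsr pC).
by have [x [[_ xC] /=]] := p_cluster _ _ F_sublevel near_p; rewrite ltNge xC.
Qed.

End RowDivergence.

Section Rescaling.
Variables (R : realType) (N : nat).
Implicit Types (A : {set 'I_N}) (x y : 'rV[R]_N).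

Definition block_sum A x : R := \sum_(i in A) x 0 i.

Definition rescale A x : 'rV[R]_N :=
  \row_i (if i \in A then x 0 i / block_sum A x else x 0 i).

Lemma block_sumB A x y : block_sum A (x - y) = block_sum A x - block_sum A y.
Proof. by rewrite /block_sum -sumrB; apply: eq_bigr => i _; rewrite !mxE. Qed.

Lemma continuous_block_sum A : continuous (block_sum A).
Proof.
move=> x; apply: (cvg_sum (F := nbhs x)) => i _.
exact: coord_continuous.
Qed.

Lemma le_block_sum A x i : nneg_rV x -> i \in A -> x 0 i <= block_sum A x.
Proof.
by move=> x_ge0 iA; rewrite /block_sum (bigD1 i) //= lerDl sumr_ge0.
Qed.

Lemma block_sum_gt0 A x : pos_rV x -> (0 < #|A|)%N -> 0 < block_sum A x.
Proof.
move=> x_gt0 /card_gt0P[i iA]; apply: lt_le_trans (x_gt0 i) _.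
by apply: le_block_sum => //; exact: pos_rVW.
Qed.

Lemma block_sum1_card_gt0 A y : block_sum A y = 1 -> (0 < #|A|)%N.
Proof.
apply: contra_eqT; rewrite card_gt0 negbK => /eqP ->.
by rewrite /block_sum big_set0 eq_sym oner_eq0.
Qed.

Lemma rescale_gt0 A x : pos_rV x -> pos_rV (rescale A x).
Proof.
move=> x_gt0 i; rewrite mxE; case: ifPn => // iA.
by rewrite divr_gt0 // block_sum_gt0 //; apply/card_gt0P; exists i.
Qed.

Lemma block_sum_rescale A x : pos_rV x -> (0 < #|A|)%N ->
  block_sum A (rescale A x) = 1.
Proof.
move=> x_gt0 A_gt0; rewrite /block_sum.
under eq_bigr => i iA do rewrite mxE iA.
by rewrite -mulr_suml divff // gt_eqF // block_sum_gt0.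
Qed.

Lemma rescale_dist A x i : pos_rV x ->
  `|rescale A x 0 i - x 0 i| <= `|block_sum A x - 1|.
Proof.
move=> x_gt0; have x_ge0 := pos_rVW x_gt0.
rewrite mxE; case: ifPn => [iA|_]; last by rewrite subrr normr0.
have xi_le := le_block_sum x_ge0 iA.
have s_gt0 : 0 < block_sum A x by exact: lt_le_trans (x_gt0 i) xi_le.
have -> : x 0 i / block_sum A x - x 0 i =
    x 0 i / block_sum A x * (1 - block_sum A x).
  by field; rewrite gt_eqF.
rewrite normrM distrC ler_piMl // ger0_norm ?divr_ge0 ?(ltW s_gt0) //.
by rewrite ler_pdivrMr // mul1r.
Qed.

Lemma kl_rescale A x y : pos_rV x -> block_sum A y = 1 ->
  kl y (rescale A x) = kl y x - kl_term 1 (block_sum A x).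
Proof.
move=> x_gt0 yA; set s := block_sum A x.
have s_gt0 : 0 < s by apply: block_sum_gt0 => //; exact: block_sum1_card_gt0 yA.
apply/eqP; rewrite eq_sym subr_eq addrC -subr_eq /kl -sumrB; apply/eqP.
rewrite (bigID (mem A)) /= [X in _ + X]big1 => [|i /negbTE iA]; last first.
  by rewrite mxE iA subrr.
rewrite addr0.
transitivity (\sum_(i in A) (x 0 i - x 0 i / s - y 0 i * ln s)).
  by apply: eq_bigr => i iA; rewrite /kl_term mxE iA -/s ln_div ?posrE //; ring.
rewrite !sumrB -!mulr_suml -!/(block_sum _ _) yA -/s divff ?gt_eqF //.
by rewrite /kl_term ln1; ring.
Qed.

End Rescaling.

Section AlmostCyclicRescaling.
Variables (R : realType) (N : nat) (J : Type) (S : J -> {set 'I_N}).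
Implicit Types y z : 'rV[R]_N.

Definition unit_sums y := forall j, block_sum (S j) y = 1.

(* Since kl y z >= 0, the identity makes z the minimizer of kl y z0 over the
   nonnegative y with unit sums. *)
Definition kl_projection z0 z := [/\ pos_rV z, unit_sums z
  & forall y, unit_sums y -> kl y z0 = kl y z + kl z z0].

Variables (x : nat -> 'rV[R]_N) (ctl : nat -> J) (p : nat).
Hypothesis x0_gt0 : pos_rV (x 0%N).
Hypothesis xS : forall t, x t.+1 = rescale (S (ctl t)) (x t).
Hypothesis ctl_almost_cyclic : forall t j,
  exists2 k, (k <= p)%N & ctl (t + k)%N = j.
Hypothesis interior : exists2 y, pos_rV y & unit_sums y.

Local Notation scale t := (block_sum (S (ctl t)) (x t)).

Lemma block_card_gt0 j : (0 < #|S j|)%N.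
Proof.
by have [y _ y_sums] := interior; exact: block_sum1_card_gt0 (y_sums j).
Qed.

Lemma iterate_gt0 t : pos_rV (x t).
Proof. by elim: t => // t IHt; rewrite xS; exact: rescale_gt0. Qed.

Lemma scale_gt0 t : 0 < scale t.
Proof. exact: block_sum_gt0 (iterate_gt0 t) (block_card_gt0 _). Qed.

Lemma kl_iterateS y t : unit_sums y ->
  kl y (x t.+1) = kl y (x t) - kl_term 1 (scale t).
Proof. by move=> y_sums; rewrite xS kl_rescale //; exact: iterate_gt0. Qed.

Lemma klB_iterate y z t : unit_sums y -> unit_sums z ->
  kl y (x t) - kl z (x t) = kl y (x 0%N) - kl z (x 0%N).
Proof.
move=> y_sums z_sums; elim: t => // t <-.
by rewrite !kl_iterateS //; ring.
Qed.

Lemma kl_iterate_nonincreasing y : unit_sums y ->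
  nonincreasing_seq (fun t => kl y (x t)).
Proof.
move=> y_sums; apply/nonincreasing_seqP => t.
by rewrite kl_iterateS // gerBl kl_term_ge0 // scale_gt0.
Qed.

Lemma kl_iterate_is_cvg y : nneg_rV y -> unit_sums y ->
  exists l : R, kl y (x t) @[t --> \oo] --> l.
Proof.
move=> y_ge0 y_sums; apply/cvg_ex.
apply: nonincreasing_is_cvgn; first exact: kl_iterate_nonincreasing.
by exists 0 => _ [t _ <-]; apply: kl_ge0 => //; exact: iterate_gt0.
Qed.

Lemma scale_cvg1 : scale t @[t --> \oo] --> (1 : R).
Proof.
apply: cvg_kl_term0 => //; first exact: scale_gt0.
have [y y_gt0 y_sums] := interior.
have [l kl_l] := kl_iterate_is_cvg (pos_rVW y_gt0) y_sums.
rewrite (_ : (fun t => _) = fun t => kl y (x t) - kl y (x t.+1)); last first.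
  by apply/funext => t; rewrite kl_iterateS // opprB subrKC.
rewrite -(subrr l); apply: cvgB => //.
by have := kl_l; rewrite -cvg_shiftS.
Qed.

Lemma iterate_increment_cvg0 : (x t.+1 - x t) @[t --> \oo] --> (0 : 'rV[R]_N).
Proof.
apply: cvg_mx => i k; rewrite ord1 !mxE.
apply: (@norm_squeeze_cvg0 _ _ _ _ _ _ (fun t => `|scale t - 1|)).
  by move=> t; rewrite !mxE xS; exact: rescale_dist (iterate_gt0 t).
by rewrite -(normr0 R^o); apply: cvg_norm; apply/subr_cvg0; exact: scale_cvg1.
Qed.

Lemma block_sum_iterate_cvg1 j : block_sum (S j) (x t) @[t --> \oo] --> (1 : R).
Proof.
apply: (@cvg_recurrent_value _ _ _ _ p.+1).
  under eq_fun do rewrite -block_sumB.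
  rewrite -(subrr (block_sum (S j) 0)) -block_sumB subr0.
  by apply: continuous_cvg iterate_increment_cvg0; exact: continuous_block_sum.
move=> t; have [k kp <-] := ctl_almost_cyclic t j; exists k.+1 => //.
by rewrite addnS xS block_sum_rescale ?block_card_gt0 //; exact: iterate_gt0.
Qed.

Lemma iterate_cluster : exists2 q, pos_rV q & cluster (x @ \oo) q.
Proof.
have [y y_gt0 y_sums] := interior.
have [|q [[q_gt0 _] q_cluster]] :=
    @compact_kl_sublevel _ _ y (kl y (x 0%N)) y_gt0 (x @ \oo) _.
  exists 0%N => // t _.
  by split; [exact: iterate_gt0|exact: kl_iterate_nonincreasing].
by exists q.
Qed.

Theorem almost_cyclic_rescaling_cvg : exists2 xs,
  kl_projection (x 0%N) xs & x @ \oo --> xs.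
Proof.
have [xs xs_gt0 xs_cluster] := iterate_cluster.
have cluster_limit (g : 'rV[R]_N -> R) (l : R) : {for xs, continuous g} ->
    g (x t) @[t --> \oo] --> l -> g xs = l.
  move=> g_cont.
  exact: (cluster_continuous_cvg (@Rhausdorff R) g_cont xs_cluster).
have kl_cont y : {for xs, continuous (kl y)} by exact: continuous_kl.
have xs_sums : unit_sums xs.
  move=> j; apply: cluster_limit (block_sum_iterate_cvg1 j).
  exact: continuous_block_sum.
exists xs; last first.
  have [l kl_l] := kl_iterate_is_cvg (pos_rVW xs_gt0) xs_sums.
  apply: cvg_kl0; [exact: pos_rVW|exact: iterate_gt0|].
  by rewrite -(klxx xs) (cluster_limit _ _ (kl_cont xs) kl_l).
split=> // y y_sums.
have gap : kl y xs - kl xs xs = kl y (x 0%N) - kl xs (x 0%N).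
  apply: (cluster_limit (fun v => kl y v - kl xs v)); first exact: continuousB.
  by under eq_fun do rewrite klB_iterate //; exact: cvg_cst.
by move: gap; rewrite klxx subr0 => ->; rewrite subrK.
Qed.

End AlmostCyclicRescaling.

Section CliqueRelaxation.
Variables (R : realType) (n m : nat) (K : 'I_m -> {set 'I_n}).
Implicit Types (c x y : 'rV[R]_(n + m)) (T : R) (lambda : 'rV[R]_m).
Local Notation S := (ext_clique K).

Lemma lshift_in_ext_clique i j : (lshift m i \in S j) = (i \in K j).
Proof.
by rewrite /ext_clique !inE eq_lrshift mem_imset //; exact: lshift_inj.
Qed.

Lemma rshift_in_ext_clique k j : (rshift n k \in S j) = (k == j).
Proof.
rewrite /ext_clique !inE (inj_eq (@rshift_inj n m)).
case: eqP => //= _; apply/imsetP => -[i _ /eqP].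
by rewrite eq_rlshift.
Qed.

Lemma ext_clique_cover E : is_clique_cover E K -> forall i, exists j, i \in S j.
Proof.
move=> [_ _ K_cover] i; case: (split_ordP i) => [k|j] ->.
  have : k \in [set: 'I_n]%SET by rewrite inE.
  rewrite K_cover => /bigcupP[j _ kj].
  by exists j; rewrite lshift_in_ext_clique.
by exists j; rewrite rshift_in_ext_clique.
Qed.

Lemma block_sum_ext_clique x j :
  block_sum (S j) x = x 0 (rshift n j) + \sum_(i in K j) x 0 (lshift m i).
Proof.
rewrite /block_sum big_split_ord /= addrC; congr (_ + _).
  by apply: big_pred1 => k; exact: rshift_in_ext_clique.
by apply: eq_bigl => i; exact: lshift_in_ext_clique.
Qed.

Lemma unit_sums_interior :
  exists2 y : 'rV[R]_(n + m), pos_rV y & unit_sums S y.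
Proof.
pose w : R := n.+1%:R^-1.
exists (row_mx (const_mx w) (\row_j (1 - #|K j|%:R * w))) => [i|j].
  case: (split_ordP i) => k ->; rewrite ?row_mxEl ?row_mxEr mxE.
    by rewrite invr_gt0 ltr0n.
  rewrite subr_gt0 ltr_pdivrMr ?ltr0n // mul1r ltr_nat ltnS.
  by rewrite -[leqRHS]card_ord max_card.
rewrite block_sum_ext_clique row_mxEr mxE.
under eq_bigr => i _ do rewrite row_mxEl mxE.
by rewrite sumr_const -[w *+ _]mulr_natl subrK.
Qed.

Lemma unit_sums_feasible x : (forall i, exists j, i \in S j) ->
  nneg_rV x -> unit_sums S x -> feasible K x.
Proof.
move=> S_cover x_ge0 x_sums; split=> // i; rewrite x_ge0 /=.
by have [j iSj] := S_cover i; rewrite -(x_sums j) le_block_sum.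
Qed.

Lemma sum_reduced_cost c lambda y :
  \sum_i reduced_cost K c lambda i * y 0 i =
  \sum_i c 0 i * y 0 i - \sum_j lambda 0 j * block_sum (S j) y.
Proof.
under eq_bigr do rewrite mulrBl mulr_suml.
rewrite sumrB (exchange_big_dep xpredT) //=; congr (_ - _).
apply: eq_bigr => j _; rewrite mulr_sumr.
by apply: eq_bigl => i; rewrite inE.
Qed.

Lemma bregman_init_gt0 c lambda T : pos_rV (bregman_init K c lambda T).
Proof. by move=> i; rewrite mxE expR_gt0. Qed.

Lemma smoothed_objective_kl c lambda T y : T != 0 -> unit_sums S y ->
  smoothed_objective c T y =
  \sum_j lambda 0 j + T * \sum_i bregman_init K c lambda T 0 i
  - T * kl y (bregman_init K c lambda T).
Proof.
move=> T_neq0 y_sums; set x0 := bregman_init K c lambda T.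
have multipliers : \sum_j lambda 0 j * block_sum (S j) y = \sum_j lambda 0 j.
  by apply: eq_bigr => j _; rewrite y_sums mulr1.
have klE : T * kl y x0 = T * \sum_i (y 0 i * ln (y 0 i) - y 0 i)
    - \sum_i reduced_cost K c lambda i * y 0 i + T * \sum_i x0 0 i.
  rewrite !mulr_sumr -sumrB -big_split /=; apply: eq_bigr => i _.
  by rewrite /kl_term [in ln (x0 _ _)]mxE expRK; field.
rewrite klE sum_reduced_cost multipliers /smoothed_objective /entropy; ring.
Qed.

Lemma kl_projection_is_solution c lambda T xs :
  (forall i, exists j, i \in S j) -> 0 < T ->
  kl_projection S (bregman_init K c lambda T) xs ->
  is_solution K c T xs /\ forall y, is_solution K c T y -> y = xs.
Proof.
move=> S_cover T_gt0 [xs_gt0 xs_sums pythagoras].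
have xs_feasible := unit_sums_feasible S_cover (pos_rVW xs_gt0) xs_sums.
have gap y : feasible K y ->
    smoothed_objective c T y = smoothed_objective c T xs - T * kl y xs.
  move=> [_ y_sums].
  rewrite !(@smoothed_objective_kl c lambda T) ?gt_eqF // pythagoras //; ring.
have feasible_ge0 y : feasible K y -> nneg_rV y.
  by move=> [y_bounds _] i; have /andP[] := y_bounds i.
split=> [|y [y_feasible /(_ _ xs_feasible)]].
  split=> // y y_feasible; rewrite gap // gerBl mulr_ge0 ?(ltW T_gt0) //.
  by rewrite kl_ge0 //; exact: feasible_ge0.
have y_ge0 := feasible_ge0 y y_feasible.
rewrite (gap y) // lerBrDr gerDl pmulr_rle0 // => kl_le0.
by apply/eqP; rewrite -kl_eq0 // eq_le kl_le0 kl_ge0.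
Qed.

Lemma bregman_iterate0 c lambda T :
  bregman_iterate K c lambda T 0 = bregman_init K c lambda T.
Proof. by rewrite /bregman_iterate div0n mod0n take0. Qed.

Lemma bregman_iterate_no_clique c lambda T t : m = 0%N ->
  bregman_iterate K c lambda T t = bregman_init K c lambda T.
Proof.
move=> m_eq0; rewrite /bregman_iterate [X in (t %/ X)%N]m_eq0 divn0.
by rewrite (size0nil (s := enum 'I_m)) ?size_enum_ord.
Qed.

Lemma bregman_iterateS c lambda T t (j : 'I_m) : (t %% m)%N = j ->
  bregman_iterate K c lambda T t.+1 =
  rescale (S j) (bregman_iterate K c lambda T t).
Proof.
move=> tj; have m_gt0 : (0 < m)%N by exact: leq_ltn_trans (ltn_ord j).
have take_enum : take j.+1 (enum 'I_m) = rcons (take j (enum 'I_m)) j.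
  by rewrite (take_nth j) ?size_enum_ord // nth_ord_enum.
rewrite -[rescale _ _]/(bregman_step K _ j) /bregman_iterate divnS // modnS tj.
case: ifP => [m_dvd|_]; last by rewrite take_enum foldl_rcons.
rewrite take0 add1n iterS /= -foldl_rcons -take_enum /bregman_outer.
rewrite take_oversize // size_enum_ord.
move: m_dvd; rewrite /dvdn -addn1 -modnDml tj addn1.
by apply: contraLR; rewrite -ltnNge => jm; rewrite modn_small.
Qed.

Lemma bregman_iterate_cvg c lambda T :
  exists2 xs, kl_projection S (bregman_init K c lambda T) xs
    & bregman_iterate K c lambda T @ \oo --> xs.
Proof.
have [m_eq0|m_gt0] := posnP m.
  exists (bregman_init K c lambda T).
    split=> [|j|y _]; [exact: bregman_init_gt0| |by rewrite klxx addr0].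
    by have := ltn_ord j; rewrite {2}m_eq0.
  rewrite (_ : bregman_iterate _ _ _ _ = cst (bregman_init K c lambda T)).
    exact: cvg_cst.
  by apply/funext => t; exact: bregman_iterate_no_clique.
rewrite -(bregman_iterate0 c lambda T).
pose ctl t := Ordinal (ltn_pmod t m_gt0).
apply: (@almost_cyclic_rescaling_cvg _ _ _ _ _ ctl m) => [|t|t j|].
- by rewrite bregman_iterate0; exact: bregman_init_gt0.
- exact: bregman_iterateS.
- have [k km tk] := exists_addn_modn t j.
  by exists k => //; exact: val_inj.
- exact: unit_sums_interior.
Qed.

End CliqueRelaxation.

Theorem proposition4 (R : realType) (n m : nat) (E : {set {set 'I_n}})
    (K : 'I_m -> {set 'I_n}) (c : 'rV[R]_(n + m)) (T : R) (lambda : 'rV[R]_m)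
    (hE : is_edge_set E) (hK : is_clique_cover E K)
    (hc : forall j : 'I_m, c 0 (rshift n j) = 0) (hT : 0 < T) :
  exists xs : 'rV[R]_(n + m),
    [/\ is_solution K c T xs,
        forall y : 'rV[R]_(n + m), is_solution K c T y -> y = xs
      & bregman_iterate K c lambda T @ \oo --> xs].
Proof.
have [xs xs_proj xs_cvg] := bregman_iterate_cvg K c lambda T.
have [xs_sol xs_uniq] :=
  kl_projection_is_solution (ext_clique_cover hK) hT xs_proj.
by exists xs.
Qed.
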